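(* Let $E$ be a Banach space. Then $\mathrm{FBL}^{(\infty)}[E]$ coincides with the lattice $C_{ph}(B_{E^*})$ of all positively homogeneous weak$^*$ continuous real-valued functions on $B_{E^*}$.
   Context: Banach spaces are real. $B_{E^*}$ is the closed unit ball of $E^*$, equipped with the relative weak$^*$ topology, and $C(B_{E^*})$ is the Banach lattice of continuous real functions on it with the sup norm. For $x\in E$ let $\delta_x(x^* )=x^*(x)$. $\mathrm{FBL}^{(\infty)}[E]$ is the closed sublattice of $C(B_{E^*})$ generated by $\{\delta_x|_{B_{E^*}}:x\in E\}$, together with the isometric embedding $\phi_E(x)=\delta_x$. (It is the free AM-space over $E$: every bounded linear operator $T:E\to X$ into an AM-space $X$ extends uniquely to a lattice homomorphism $\widehat T:\mathrm{FBL}^{(\infty)}[E]\to X$ with $\widehat T\phi_E=T$ and $\|\widehat T\|=\|T\|$.) A function $f$ on $B_{E^*}$ is positively homogeneous if $f(\lambda x^* )=\lambda f(x^* )$ whenever $\lambda\ge 0$ and $x^*,\lambda x^*\in B_{E^*}$. *)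

(* Defs.v *)
From HB Require Import structures.
From mathcomp Require Import all_boot all_order all_algebra.
From mathcomp Require Import all_classical all_reals all_analysis.

Set Implicit Arguments.
Unset Strict Implicit.
Unset Printing Implicit Defensive.

Import Order.TTheory GRing.Theory Num.Theory numFieldNormedType.Exports.
Local Open Scope classical_set_scope.
Local Open Scope ring_scope.

(* The elements of E^* are taken in [{ptws E -> R}]: the topology of pointwise
   convergence is the weak* topology. *)
Definition dual (R : realType) (E : normedModType R) : set {ptws E -> R} :=
  [set u | scalar (u : E -> R) /\ continuous (u : E -> R)].
Arguments dual {R} E.

(* [sup] is a junk value on unbounded sets; the set below is bounded as soon as
   u is in [dual E]. *)
Definition dual_norm (R : realType) (E : normedModType R) (u : E -> R) : R :=
  sup [set `|u x| | x in [set x : E | `|x| <= 1]].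

(* Used as a type, this set carries the topology induced by [{ptws E -> R}],
   that is, the relative weak* topology. *)
Definition dual_ball (R : realType) (E : normedModType R) :
    set {ptws E -> R} :=
  dual E `&` [set u | dual_norm u <= 1].
Arguments dual_ball {R} E.

Definition delta (R : realType) (E : normedModType R) (x : E)
    (u : dual_ball E) : R :=
  set_val u x.
Arguments delta {R E} x u.

(* Meant for bounded f, as every continuous f is on a compact space. *)
Definition sup_norm (R : realType) (T : Type) (f : T -> R) : R :=
  sup (range (fun t => `|f t|)).

Definition continuous_functions (R : realType) (K : topologicalType) :
    set (K -> R) :=
  [set f | continuous f].
Arguments continuous_functions R K : clear implicits.

(* A linear sublattice of C(K), for K compact, closed in C(K) for [sup_norm]. *)
Record closed_sublattice (R : realType) (K : topologicalType)
    (S : set (K -> R)) : Prop := ClosedSublattice {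
  closed_sublattice_sub : S `<=` continuous_functions R K ;
  closed_sublattice0 : S (fun=> 0) ;
  closed_sublatticeD : forall f g, S f -> S g -> S (fun t => f t + g t) ;
  closed_sublatticeZ : forall (a : R) f, S f -> S (fun t => a * f t) ;
  closed_sublattice_max :
    forall f g, S f -> S g -> S (fun t => Num.max (f t) (g t)) ;
  closed_sublattice_min :
    forall f g, S f -> S g -> S (fun t => Num.min (f t) (g t)) ;
  closed_sublattice_closed : forall f, continuous f ->
    (forall e : R, 0 < e ->
       exists2 g, S g & sup_norm (fun t => f t - g t) < e) -> S f }.

Definition FBLoo (R : realType) (E : normedModType R) :
    set (dual_ball E -> R) :=
  smallest (@closed_sublattice R (dual_ball E)) (range (@delta R E)).
Arguments FBLoo {R} E.

(* The product l u^* need not lie in the ball, hence the extra point v. *)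
Definition positively_homogeneous (R : realType) (E : normedModType R)
    (f : dual_ball E -> R) : Prop :=
  forall (l : R) (u v : dual_ball E), 0 <= l ->
    (forall x : E, set_val v x = l * set_val u x) -> f v = l * f u.

Definition Cph (R : realType) (E : normedModType R) :
    set (dual_ball E -> R) :=
  [set f | continuous f /\ positively_homogeneous f].
Arguments Cph {R} E.

(* Main.v *)
Require Import Defs.
From HB Require Import structures.
From mathcomp Require Import all_boot all_order all_algebra.
From mathcomp Require Import all_classical all_reals all_analysis.
From mathcomp Require Import ring lra.

(** Elements of FBL^(oo)[E] are positively homogeneous because positive
    homogeneity passes to uniform limits.  Conversely, the ball of E^* is weak*
    compact (Banach-Alaoglu), so by the lattice form of the Stone-Weierstrass
    theorem it is enough to match a positively homogeneous f at any two points
    s, t by an element of the lattice.  If s and t are linearly independent,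
    some delta_x does it; if t = l s with l >= 0, homogeneity of f makes a
    multiple of delta_x do it; and if t = l s with l < 0, a combination of the
    positive and negative parts of delta_x does it. *)

Set Implicit Arguments.
Unset Strict Implicit.
Unset Printing Implicit Defensive.

Import Order.TTheory GRing.Theory Num.Theory numFieldNormedType.Exports.
Local Open Scope classical_set_scope.
Local Open Scope ring_scope.

(** * Compactness and the sup norm *)

(** If [P] failed on the whole space, the complements of the sets satisfying [P] would form a proper
    filter, and a cluster point of it would contradict the local hypothesis. *)
Lemma compact_ind (K : topologicalType) (P : set K -> Prop) :
  compact [set: K] -> P set0 ->
  (forall A B, A `<=` B -> P B -> P A) ->
  (forall A B, P A -> P B -> P (A `|` B)) ->
  (forall x : K, exists2 U : set K, nbhs x U & P U) -> P [set: K].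
Proof.
move=> cK P0 PS PU Pnbhs; apply: contrapT => nPT.
pose F : set_system K := [set A | P (~` A)].
have FF : ProperFilter F.
  split; first by rewrite /F /= setC0.
  split; rewrite /F /=.
  - by rewrite setCT.
  - by move=> A B PA PB; rewrite /mkset setCI; exact: PU.
  - by move=> A B AB; apply: PS; exact: subsetC.
have [x [_ Fx]] := cK F FF (filterT (F := F)).
have [U xU PUx] := Pnbhs x.
have [|y []] := Fx (~` U) U _ xU; last by [].
by rewrite /F /= setCK.
Qed.

Lemma compact_set_type (X : topologicalType) (A : set X) :
  compact A -> compact [set: A].
Proof.
move=> cA F FF _.
have GA : (set_val @ F) A.
  rewrite /= /nbhs /=; apply: filterS (filterT (F := F)) => a _.
  exact: set_valP.
have [p [Ap Fp]] := cA _ (fmap_proper_filter _ FF) GA.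
exists (exist _ p (mem_set Ap)); split=> // P B FP [_ [[V oV <-] Vp VB]].
have GP : (set_val @ F) (set_val @` P).
  by rewrite /= /nbhs /=; apply: filterS FP => a Pa; exists a.
have [_ [[a Pa <-] Va]] := Fp _ V GP (open_nbhs_nbhs (conj oV Vp)).
by exists a; split=> //; exact: VB.
Qed.

Lemma sup_norm_le (R : realType) (T : Type) (f : T -> R) (e : R) :
  0 <= e -> (forall t, `|f t| <= e) -> sup_norm f <= e.
Proof.
move=> e0 fe; rewrite /sup_norm.
(* For empty [T] the supremum takes its default value 0, whence [0 <= e]. *)
have [->|/set0P A0] := eqVneq (range (fun t => `|f t|)) set0.
  by rewrite sup0.
by apply: ge_sup => // _ [t _ <-].
Qed.

Lemma sup_norm_ge (R : realType) (K : topologicalType) (f : K -> R) (t : K) :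
  compact [set: K] -> continuous f -> `|f t| <= sup_norm f.
Proof.
move=> cK cf; apply: ub_le_sup; last by exists t.
have /compact_bounded [M [_ MB]] :=
  continuous_compact (continuous_subspaceT (A := [set: K]) cf) cK.
exists (M + 1) => _ [s _ <-]; apply: MB; first by rewrite ltrDl.
by exists s.
Qed.

(** * Lattice form of the Stone-Weierstrass theorem *)

(** Two compactness passes: with [s] fixed, a maximum of finitely many interpolants exceeds [f - e]
    everywhere and stays below [f s + e] at [s]; a minimum of finitely many such functions is then
    uniformly close to [f]. *)
Lemma lattice_Stone_Weierstrass (R : realType) (K : topologicalType)
    (S : set (K -> R)) (f : K -> R) :
  compact [set: K] -> closed_sublattice S -> continuous f ->
  (forall s t, exists2 g, S g & g s = f s /\ g t = f t) -> S f.
Proof.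
move=> cK [Scont S0 _ _ Smax Smin Sclosed] cf fS.
have above e s : 0 < e ->
    exists2 g, S g & g s < f s + e /\ forall t, f t - e < g t.
  move=> e0.
  suff [g Sg [gs ge]] : exists2 g, S g &
      g s < f s + e /\ forall t, [set: K] t -> f t - e < g t.
    by exists g => //; split=> // t; exact: ge.
  apply: (@compact_ind K (fun A => exists2 g, S g &
    g s < f s + e /\ forall t, A t -> f t - e < g t)) => //.
  - have [g Sg [gs _]] := fS s s.
    by exists g => //; split=> //; rewrite gs ltrDl.
  - by move=> A B AB [g Sg [gs gB]]; exists g => //; split=> // t /AB/gB.
  - move=> A B [g Sg [gs gA]] [h Sh [hs hB]].
    exists (fun t => Num.max (g t) (h t)); first exact: Smax.
    split=> [|t [/gA|/hB] tlt]; rewrite ?gt_max ?gs ?hs// lt_max tlt ?orbT//.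
  - move=> t; have [g Sg [gs gt]] := fS s t.
    exists [set u | f u - e < g u]; last first.
      by exists g => //; split=> //; rewrite gs ltrDl.
    have /cvgrPdist_lt /(_ e e0) : f u - g u @[u --> t] --> f t - g t.
      by apply: cvgB; [exact: cf|exact: Scont Sg t].
    by apply: filterS => u /=; rewrite gt subrr sub0r normrN ltr_norml; lra.
apply: Sclosed => // e e0; have e20 : 0 < e / 2 by rewrite divr_gt0.
suff [g Sg ge] : exists2 g, S g &
    (forall t, [set: K] t -> g t < f t + e / 2) /\ forall t, f t - e / 2 < g t.
  exists g => //; have [gu gl] := ge.
  apply: (@le_lt_trans _ _ (e / 2)); last lra.
  apply: sup_norm_le => [|t]; first lra.
  by have := gu t I; have := gl t; rewrite ler_norml; lra.
apply: (@compact_ind K (fun A => exists2 g, S g &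
  (forall t, A t -> g t < f t + e / 2) /\ forall t, f t - e / 2 < g t)) => //.
(* On the empty set only the lower bound remains; any function from [above] has it, but choosing one
   takes a point of [K]. *)
- have [[s _]|K0] := pselect (exists s : K, True).
    by have [g Sg [_ gl]] := above _ s e20; exists g.
  by exists (fun=> 0) => //; split=> // t; exfalso; apply: K0; exists t.
- by move=> A B AB [g Sg [gB gl]]; exists g => //; split=> // t /AB/gB.
- move=> A B [g Sg [gA gl]] [h Sh [hB hl]].
  exists (fun t => Num.min (g t) (h t)); first exact: Smin.
  by split=> [t [/gA|/hB] tlt|t]; rewrite ?lt_min ?gl ?hl// gt_min tlt ?orbT.
- move=> t; have [g Sg [gt gl]] := above _ t e20.
  exists [set u | g u < f u + e / 2]; last by exists g.
  have d0 : 0 < f t + e / 2 - g t by lra.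
  have /cvgrPdist_lt /(_ _ d0) : f u - g u @[u --> t] --> f t - g t.
    by apply: cvgB; [exact: cf|exact: Scont Sg t].
  by apply: filterS => u /=; rewrite ltr_norml; lra.
Qed.

(** * The dual ball and Banach-Alaoglu *)

Lemma scalar_continuous_le (R : realType) (E : normedModType R) (u : E -> R) :
  scalar u -> (forall x, `|u x| <= `|x|) -> continuous u.
Proof.
move=> lu ule x; apply/cvgrPdist_lt => e e0.
have /cvgrPdist_lt /(_ e e0) : id y @[y --> x] --> x by [].
apply: filterS => y; apply: le_lt_trans.
rewrite -[u x - u y]addrC -mulN1r -lu scaleN1r addrC; exact: ule.
Qed.

Lemma dual_norm_ge (R : realType) (E : normedModType R) (u : E -> R) (x : E) :
  dual E u -> `|u x| <= dual_norm u * `|x|.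
Proof.
move=> [lu cu].
pose L : {linear E -> R^o} := HB.pack u (GRing.isLinear.Build R E R^o _ u lu).
have uZ a y : u (a *: y) = a * u y by exact: (linearZZ L).
have u0 : u 0 = 0 by exact: (linear0 L).
have /linear_boundedP [r [_ rB]] : bounded_near L (nbhs (0 : E)).
  by apply/linear_bounded_continuous.
have [->|x0] := eqVneq x 0; first by rewrite u0 !normr0 mulr0.
have nx0 : 0 < `|x| by rewrite normr_gt0.
rewrite -ler_pdivrMr//; apply: ub_le_sup.
  (* The sign of [r + 1] is unknown; the maximum with 0 makes the bound monotone in the norm of
     [y]. *)
  exists (Num.max (r + 1) 0) => _ [y /= y1 <-].
  have /(_ y) uy : forall y : E, `|L y| <= (r + 1) * `|y|.
    by apply: rB; rewrite ltrDl.
  apply: (le_trans uy); apply: (@le_trans _ _ (Num.max (r + 1) 0 * `|y|)).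
    by rewrite ler_wpM2r// le_max lexx.
  by rewrite ler_piMr// le_max lexx orbT.
exists (`|x|^-1 *: x).
  by rewrite /= normrZ normfV normr_id mulVf// gt_eqF.
by rewrite uZ normrM normfV normr_id mulrC.
Qed.

(** Turns the ball into pointwise conditions, suited to the product topology; continuity is absorbed
    by the bound. *)
Lemma dual_ballE (R : realType) (E : normedModType R) :
  dual_ball E = [set u | scalar (u : E -> R) /\ forall x, `|u x| <= `|x|].
Proof.
apply/seteqP; split=> u /=.
  move=> [du u1]; split=> [|x]; first by case: du.
  by apply: (le_trans (dual_norm_ge x du)); rewrite ler_piMl.
move=> [lu ule]; split; first by split=> //; exact: scalar_continuous_le.
apply: ge_sup; first by exists `|u 0|; exists 0; rewrite //= normr0.
by move=> _ [x /= x1 <-]; exact: le_trans x1.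
Qed.

Lemma ptws_eval_continuous (R : realType) (T : choiceType) (x : T) :
  continuous (fun u : {ptws T -> R} => u x).
Proof. exact: (@proj_continuous T (fun=> R) x). Qed.

Lemma dual_ball_compact (R : realType) (E : normedModType R) :
  compact (dual_ball E).
Proof.
pose box : set {ptws E -> R} := [set u | forall x, u x \in `[- `|x|, `|x|]].
have cbox : compact box.
  exact: (@tychonoff E (fun=> R) (fun x => `[- `|x|, `|x| ]%classic)
    (fun x => @segment_compact R _ _)).
(* Linearity is an intersection of zero sets of continuous functions of [u], so the ball is closed
   in the Tychonoff-compact [box]. *)
pose lin (a : R) (x y : E) : set {ptws E -> R} :=
  (fun u => u (a *: x + y) - (a * u x + u y)) @^-1` [set 0].
suff -> : dual_ball E = box `&` \bigcap_p lin p.1.1 p.1.2 p.2.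
  apply: compact_closedI => //; apply: closed_bigI => -[[a x] y] _ /=.
  apply: preimage_closed; last exact: closed_eq.
  move=> u _.
  have ev (z : E) : {for u, continuous (fun v : {ptws E -> R} => (v z : R^o))}.
    exact: ptws_eval_continuous.
  have cev : {for u, continuous (fun v : {ptws E -> R} => (a * v x : R^o))}.
    exact: (continuousM (cvg_cst a) (ev x)).
  exact: (continuousB (ev _) (continuousD cev (ev y))).
rewrite dual_ballE; apply/seteqP; split=> u /=.
  move=> [lu ule]; split=> [x|[[a x] y] _ /=].
    by rewrite in_itv/= -ler_norml.
  by rewrite /lin /= lu subrr.
move=> [ub ul]; split=> [a x y|x].
  by apply/eqP; rewrite -subr_eq0; apply/eqP; exact: (ul (a, x, y)).
by have := ub x; rewrite in_itv/= -ler_norml.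
Qed.

Lemma dual_ball_compactT (R : realType) (E : normedModType R) :
  compact [set: dual_ball E].
Proof. exact/compact_set_type/dual_ball_compact. Qed.

(** * Evaluations and positively homogeneous functions *)

Lemma delta_continuous (R : realType) (E : normedModType R) (x : E) :
  continuous (delta x : dual_ball E -> R).
Proof.
move=> u.
apply: (@continuous_comp _ _ _ set_val (fun v : {ptws E -> R} => v x)).
  exact: initial_continuous.
exact: ptws_eval_continuous.
Qed.

Section delta_linear.
Variables (R : realType) (E : normedModType R) (u : dual_ball E).

Let delta_scalar : scalar (fun x : E => delta x u).
Proof. by case: (set_valP u) => -[]. Qed.

Lemma deltaD x y : delta (x + y) u = delta x u + delta y u.
Proof. by have := delta_scalar 1 x y; rewrite scale1r mul1r. Qed.

Lemma delta0 : delta 0 u = 0.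
Proof. by have := deltaD 0 0; rewrite addr0; lra. Qed.

Lemma deltaZ a x : delta (a *: x) u = a * delta x u.
Proof. by have := delta_scalar a x 0; rewrite delta0 !addr0. Qed.

End delta_linear.

Lemma Cph_closed_sublattice (R : realType) (E : normedModType R) :
  closed_sublattice (@Cph R E).
Proof.
split.
- by move=> f [].
- split; first by move=> x; exact: cst_continuous.
  by move=> l u v _ _ /=; rewrite mulr0.
- move=> f g [cf hf] [cg hg]; split.
    by move=> x; exact: (continuousD (cf x) (cg x)).
  by move=> l u v l0 uv; rewrite (hf l u v)// (hg l u v)// mulrDr.
- move=> a f [cf hf]; split.
    by move=> x; exact: (continuousM (@cst_continuous _ _ a x) (cf x)).
  by move=> l u v l0 uv; rewrite (hf l u v)// mulrCA.
- move=> f g [cf hf] [cg hg]; split.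
    by move=> x; exact: (continuous_max (cf x) (cg x)).
  by move=> l u v l0 uv; rewrite (hf l u v)// (hg l u v)// maxr_pMr.
- move=> f g [cf hf] [cg hg]; split.
    by move=> x; exact: (continuous_min (cf x) (cg x)).
  by move=> l u v l0 uv; rewrite (hf l u v)// (hg l u v)// minr_pMr.
- move=> f cf fS; split=> // l u v l0 uv.
  apply/eqP; rewrite -subr_eq0 -normr_le0; apply/ler_addgt0Pr => e e0.
  (* The error at [v] plus [l] times the error at [u] must total at most [e]. *)
  have d0 : 0 < e / (1 + l) by rewrite divr_gt0// ltr_wpDr.
  have [g [cg hg] fg] := fS _ d0.
  have fgt t : `|f t - g t| < e / (1 + l).
    apply: le_lt_trans fg; apply: (@sup_norm_ge _ _ (fun t => f t - g t)).
      exact: dual_ball_compactT.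
    by move=> x; exact: (continuousB (cf x) (cg x)).
  have -> : f v - l * f u = (f v - g v) - l * (f u - g u).
    by rewrite (hg l u v)//; ring.
  rewrite add0r; apply: (le_trans (ler_normB _ _)).
  rewrite normrM (ger0_norm l0).
  have -> : e = e / (1 + l) + l * (e / (1 + l)).
    by field; rewrite gt_eqF// ltr_wpDr.
  by apply: lerD; [exact: ltW|rewrite ler_wpM2l// ltW].
Qed.

Lemma delta_Cph (R : realType) (E : normedModType R) (x : E) :
  Cph E (delta x).
Proof.
by split=> [|l u v _ uv]; [exact: delta_continuous|exact: uv].
Qed.

(** * Interpolation at two points *)

Lemma dual_ball_proportional (R : realType) (E : normedModType R)
    (s t : dual_ball E) :
  (forall x, delta x s = 0 -> delta x t = 0) ->
  exists l : R, forall x, delta x t = l * delta x s.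
Proof.
move=> st; have [[y sy]|s0] := pselect (exists y, delta y s != 0); last first.
  exists 0 => x; rewrite mul0r; apply: st.
  by apply: contrapT => /eqP sx; apply: s0; exists x.
exists (delta y t / delta y s) => x.
(* Subtracting this multiple of [y] projects [x] into the kernel of [s], hence into that of [t]. *)
have : delta (x + (- (delta x s / delta y s)) *: y) t = 0.
  by apply: st; rewrite deltaD deltaZ; field.
rewrite deltaD deltaZ => e.
by apply/eqP; rewrite -subr_eq0 -[0]e; apply/eqP; field.
Qed.

Lemma interpolation_proportional (R : realType) (E : normedModType R)
    (S : set (dual_ball E -> R)) (f : dual_ball E -> R) (s t : dual_ball E)
    (l : R) :
  closed_sublattice S -> range (@delta R E) `<=` S ->
  positively_homogeneous f -> (forall x, delta x t = l * delta x s) ->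
  exists2 g, S g & g s = f s /\ g t = f t.
Proof.
move=> [_ S0 SD SZ Smax _ _] Sd hf st.
have Sdx x : S (delta x) by apply: Sd; exists x.
have [[y sy]|s0] := pselect (exists y, delta y s != 0); last first.
  have {}s0 x : delta x s = 0.
    by apply: contrapT => /eqP sx; apply: s0; exists x.
  exists (fun=> 0) => //.
  (* Both points are the zero functional, where homogeneity with factor 0 forces [f] to vanish. *)
  have fs : f s = 0 * f s by apply: hf => // x; rewrite mul0r; exact: s0.
  have ft : f t = 0 * f s.
    by apply: hf => // x; rewrite mul0r; have := st x; rewrite s0 mulr0.
  by rewrite ft fs !mul0r.
pose x := (delta y s)^-1 *: y.
have xs : delta x s = 1 by rewrite deltaZ mulVf.
have xt : delta x t = l by rewrite st xs mulr1.
have [l0|l0] := leP 0 l.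
  exists (fun u => f s * delta x u); first exact/SZ/Sdx.
  by rewrite xs xt mulr1 (hf l s t l0 st) mulrC.
have Spos a : S (fun u => Num.max (a * delta x u) 0).
  exact: Smax (SZ a _ (Sdx x)) S0.
(* For [l < 0] the positive part of [delta x] is 1 at [s] and 0 at [t], the negative part 0 at [s]
   and [- l] at [t]. *)
exists (fun u => f s * Num.max (1 * delta x u) 0
               + - f t / l * Num.max (-1 * delta x u) 0).
  exact: SD (SZ _ _ (Spos 1)) (SZ _ _ (Spos (-1))).
rewrite xs xt !mul1r; split.
  by rewrite mulr1 max_l// max_r ?oppr_le0// mulr0 addr0 mulr1.
rewrite (@max_r _ _ l 0); last exact: ltW.
by rewrite max_l; [field; rewrite lt_eqF | lra].
Qed.

Lemma interpolation (R : realType) (E : normedModType R)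
    (S : set (dual_ball E -> R)) (f : dual_ball E -> R) (s t : dual_ball E) :
  closed_sublattice S -> range (@delta R E) `<=` S ->
  positively_homogeneous f ->
  exists2 g, S g & g s = f s /\ g t = f t.
Proof.
move=> SS Sd hf.
have [/dual_ball_proportional [l lst]|/existsNP [x /not_implyP [sx /eqP tx]]] :=
    pselect (forall x, delta x s = 0 -> delta x t = 0).
  exact: interpolation_proportional SS Sd hf lst.
have [/dual_ball_proportional [l lst]|/existsNP [y /not_implyP [ty /eqP sy]]] :=
    pselect (forall x, delta x t = 0 -> delta x s = 0).
  have [g Sg [gt gs]] := interpolation_proportional SS Sd hf lst.
  by exists g.
(* Neither kernel contains the other: [x] is killed by [s] only and [y] by [t] only, so the two
   coefficients are adjusted separately. *)
exists (delta ((f t / delta x t) *: x + (f s / delta y s) *: y)).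
  by apply: Sd; eexists.
by rewrite !deltaD !deltaZ sx ty !mulr0 add0r addr0 !divfK.
Qed.

Theorem proposition2p2 (R : realType) (E : completeNormedModType R) :
  FBLoo E = Cph E.
Proof.
apply/seteqP; split.
  apply: smallest_sub; first exact: Cph_closed_sublattice.
  by move=> _ [x _ <-]; exact: delta_Cph.
(* Belonging to the smallest closed sublattice means belonging to every closed sublattice [S] that
   contains the evaluations. *)
move=> f [cf hf] S [SS Sd].
apply: (lattice_Stone_Weierstrass (@dual_ball_compactT R E) SS cf).
by move=> s t; exact: interpolation.
Qed.
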